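(* The magneto-spectral height of the hypercube $Q^d$, $d\ge 2$, is given by $$\nu(Q^d)=d-\sqrt d.$$ Moreover, the maximal magnetic potentials of $Q^d$ are precisely the magnetic potentials which assume the value $-1$ on each $4$-cycle of $Q^d$. In particular, any two maximal magnetic potentials of $Q^d$ are gauge equivalent.
   Context: All graphs $G=(V,E)$ are finite and simple; $x\sim y$ denotes adjacency. $E^{or}(G)$ is the set of ordered pairs $(x,y)$ with $x\sim y$. A magnetic potential is a map $\sigma:E^{or}(G)\to S^1=\{z\in\mathbb{C}:|z|=1\}$ with $\sigma(y,x)=\sigma(x,y)^{-1}$. The magnetic Laplacian on functions $f:V\to\mathbb{C}$ is $\Delta^\sigma f(x)=\sum_{y\sim x}(f(x)-\sigma(x,y)f(y))$, and $\lambda_1^\sigma(G)$ is its smallest eigenvalue. The magneto-spectral height is $\nu(G)=\sup_\sigma\lambda_1^\sigma(G)$, over all magnetic potentials; $\sigma$ is maximal if $\lambda_1^\sigma(G)=\nu(G)$. The value of $\sigma$ on a cycle $x_1\sim x_2\sim x_3\sim x_4\sim x_1$ is the product $\sigma(x_1,x_2)\sigma(x_2,x_3)\sigma(x_3,x_4)\sigma(x_4,x_1)$. Two magnetic potentials $\sigma_1,\sigma_2$ are gauge equivalent if there is $\tau:V\to S^1$ with $\sigma_2(x,y)=\tau(x)^{-1}\sigma_1(x,y)\tau(y)$ for all $(x,y)\in E^{or}(G)$. $Q^d=(K_2)^d$ is the $d$-dimensional hypercube: vertices are $\{0,1\}^d$, adjacent iff they differ in exactly one coordinate. *)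

(* Defs.v *)
From HB Require Import structures.
From mathcomp Require Import all_boot all_order all_algebra.
From mathcomp Require Import boolp classical_sets reals.
From mathcomp Require Import complex.

Set Implicit Arguments.
Unset Strict Implicit.
Unset Printing Implicit Defensive.
Import Order.TTheory GRing.Theory Num.Theory.

Local Open Scope ring_scope.
Local Open Scope complex_scope.

Record sgraph := SGraph {
  vertex :> finType;
  adj : rel vertex;
  adj_sym : symmetric adj;
  adj_irrefl : irreflexive adj
}.

(* A magnetic potential on E^or(G) is represented by a function on all pairs of
   vertices; only its values on adjacent pairs are constrained or ever used. *)
Definition magnetic_potential (R : realType) (G : sgraph)
    (sigma : G -> G -> R[i]) : Prop :=
  forall x y, adj x y -> `|sigma x y| = 1 /\ sigma y x = (sigma x y)^-1.

Definition magnetic_laplacian (R : realType) (G : sgraph)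
    (sigma : G -> G -> R[i]) (f : {ffun G -> R[i]^o}) : {ffun G -> R[i]^o} :=
  [ffun x => \sum_(y | adj x y) (f x - sigma x y * f y)].

Lemma magnetic_laplacian_is_linear (R : realType) (G : sgraph)
    (sigma : G -> G -> R[i]) : linear (magnetic_laplacian sigma).
Proof.
move=> a f g; apply/ffunP=> x; rewrite !ffunE scaler_sumr -big_split /=.
apply: eq_bigr => y _; rewrite !ffunE /= /GRing.scale /=.
by rewrite !mulrDr opprD addrACA mulrN (mulrCA a).
Qed.

HB.instance Definition _ (R : realType) (G : sgraph)
    (sigma : G -> G -> R[i]) :=
  GRing.isLinear.Build R[i] {ffun G -> R[i]^o} {ffun G -> R[i]^o} *:%R
    (magnetic_laplacian sigma) (magnetic_laplacian_is_linear sigma).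

Definition magnetic_eigenvalue (R : realType) (G : sgraph)
    (sigma : G -> G -> R[i]) (z : R[i]) : bool :=
  passmx.leigenvalue (linfun (magnetic_laplacian sigma)) z.

Lemma magnetic_eigenvalueP (R : realType) (G : sgraph)
    (sigma : G -> G -> R[i]) (z : R[i]) :
  reflect (exists2 f : {ffun G -> R[i]^o},
             f != 0 & magnetic_laplacian sigma f = z *: f)
          (magnetic_eigenvalue sigma z).
Proof.
have kerE f : (f \in lker (linfun (magnetic_laplacian sigma) - z *: \1%VF)) =
    (magnetic_laplacian sigma f == z *: f).
  by rewrite memv_ker add_lfunE opp_lfunE scale_lfunE id_lfunE lfunE subr_eq0.
apply: (iffP idP) => [ker_neq0 | [f f_neq0 /eqP]].
  by exists (vpick (passmx.leigenspace (linfun (magnetic_laplacian sigma)) z));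
    [rewrite vpick0 | apply/eqP; rewrite -kerE memv_pick].
rewrite -kerE; apply: contraTneq; rewrite /passmx.leigenspace => ->.
by rewrite memv0.
Qed.

(* On R[i], a <= b means that b - a is real and nonnegative, so being below
   every eigenvalue includes that the spectrum is real; this holds for every
   magnetic potential, whose Laplacian is Hermitian. The default value 0 is
   reached only if there is no smallest eigenvalue (e.g. on the empty graph). *)
Definition lambda1 (R : realType) (G : sgraph) (sigma : G -> G -> R[i]) : R :=
  xget 0 [set l : R | magnetic_eigenvalue sigma l%:C /\
    forall z : R[i], magnetic_eigenvalue sigma z -> l%:C <= z]%classic.

Definition magneto_spectral_height (R : realType) (G : sgraph) : R :=
  sup [set lambda1 sigma | sigma in @magnetic_potential R G]%classic.

Definition maximal_potential (R : realType) (G : sgraph)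
    (sigma : G -> G -> R[i]) : Prop :=
  magnetic_potential sigma /\ lambda1 sigma = magneto_spectral_height R G.

Definition gauge_equivalent (R : realType) (G : sgraph)
    (sigma1 sigma2 : G -> G -> R[i]) : Prop :=
  exists tau : G -> R[i], (forall x, `|tau x| = 1) /\
    forall x y, adj x y -> sigma2 x y = (tau x)^-1 * sigma1 x y * tau y.

(* [ucycle] requires the four vertices to be pairwise distinct: on a degenerate
   closed walk such as x1, x2, x1, x2 the product is always 1. *)
Definition minus_one_on_4cycles (R : realType) (G : sgraph)
    (sigma : G -> G -> R[i]) : Prop :=
  forall x1 x2 x3 x4 : G, ucycle (@adj G) [:: x1; x2; x3; x4] ->
    sigma x1 x2 * sigma x2 x3 * sigma x3 x4 * sigma x4 x1 = -1.

Definition cube_adj (d : nat) : rel {ffun 'I_d -> bool} :=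
  [rel u v : {ffun 'I_d -> bool} | #|[set i | u i != v i]| == 1%N].

Lemma cube_adj_sym d : symmetric (@cube_adj d).
Proof.
move=> u v; rewrite /cube_adj /=; congr (_ == _).
by apply: eq_card => i; rewrite !inE eq_sym.
Qed.

Lemma cube_adj_irrefl d : irreflexive (@cube_adj d).
Proof.
by move=> u; rewrite /cube_adj /= eq_card0 // => i; rewrite !inE eqxx.
Qed.

Definition hypercube (d : nat) : sgraph :=
  SGraph (@cube_adj_sym d) (@cube_adj_irrefl d).

(* Main.v *)
Require Import Defs.
From mathcomp Require Import all_boot all_order all_algebra.
From mathcomp Require Import boolp classical_sets reals.
From mathcomp Require Import complex.
Import Order.TTheory GRing.Theory Num.Theory.
Local Open Scope ring_scope.
Local Open Scope complex_scope.

(** Write [A] for the magnetic adjacency operator, so that the Laplacian of a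
[d]-regular graph is [d - A], and let [N] be the number of vertices.  Each
diagonal entry of [A ^ 2] is a sum over the [d] edges at a vertex of
[sigma x y * sigma y x = 1], so [tr (A ^ 2) = d * N] whatever the potential.
The operator [A] is Hermitian, and on a bipartite graph its spectrum is
symmetric about [0]; hence its largest eigenvalue [m] bounds all of them in
absolute value and [d * N <= N * m ^ 2], that is [m >= sqrt d], or
[lambda_1 = d - m <= d - sqrt d].  In the case of equality every eigenvalue of
[A ^ 2] is [d], so [A ^ 2 = d] ([bipartite_regular_bound]).  Conversely
[A ^ 2 = d] forces the eigenvalues of [A] to lie in [{sqrt d, - sqrt d}], and
[sqrt d] occurs because [A + sqrt d] has its image in that eigenspace and is
not zero ([lambda1_of_square]).

On the hypercube, [A ^ 2] relates a vertex to itself and to the vertices at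
distance [2], and each of the latter is reached by exactly two walks of length
[2], which together form a 4-cycle.  So [A ^ 2 = d] says that the products of
[sigma] along the two walks are opposite, which is the property of being [-1]
on all 4-cycles.  In between stands the predicate [anticommuting]: the [d]
operators moving along one coordinate pairwise anticommute, as the generators
of a Clifford algebra do.

The bound is attained because an anticommuting potential exists, namely the
sign rule of Clifford multiplication ([alternating_potential]).  Two
anticommuting potentials have a quotient with value [1] on all 4-cycles, and
such a potential on the hypercube is a gradient ([flat_potential_gradient]),
which gives the gauge equivalence. *)

(** * Hermitian matrices and the trace of their square *)

Lemma spectral_diag_eigenvalue {C : numClosedFieldType} {n} (A : 'M[C]_n) i :
  A \is hermsymmx -> eigenvalue A (spectral_diag A 0 i).
Proof.
move=> /hermitian_normalmx/orthomx_spectralP; set P := spectralmx A => AE.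
apply/eigenvalueP; exists (row i P).
  rewrite {1}AE !mulmxA -row_mul mulmxV ?spectral_unit // row1.
  by rewrite -rowE row_diag_mx -scalemxAl -rowE.
rewrite rowE; apply/eqP => /(congr1 (mulmx^~ (invmx P))).
rewrite mul0mx mulmxK ?spectral_unit // => /matrixP/(_ 0 i)/eqP.
by rewrite !mxE !eqxx oner_eq0.
Qed.

Lemma hermitian_squareE {C : numClosedFieldType} {n} (A : 'M[C]_n) :
    A \is hermsymmx ->
  A *m A = invmx (spectralmx A) *m
    diag_mx (\row_i spectral_diag A 0 i ^+ 2) *m spectralmx A.
Proof.
move=> /hermitian_normalmx/orthomx_spectralP; set P := spectralmx A => AE.
have -> : diag_mx (\row_i spectral_diag A 0 i ^+ 2) =
    diag_mx (spectral_diag A) *m diag_mx (spectral_diag A).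
  by rewrite mulmx_diag; congr diag_mx; apply/rowP => i; rewrite !mxE expr2.
by rewrite {1 2}AE !mulmxA mulmxK ?spectral_unit.
Qed.

(** The trace of [A ^ 2] is the sum of the squared eigenvalues, so their mean is
[a], while each of them is at most [m ^ 2].  A mean equal to the maximum makes
all squared eigenvalues equal, and a diagonalizable matrix with a single
eigenvalue is scalar. *)
Lemma hermitian_square_bound {C : numClosedFieldType} {n} (A : 'M[C]_n)
    (m a : C) :
    A \is hermsymmx -> (0 < n)%N -> \tr (A *m A) = a *+ n ->
    (forall z, eigenvalue A z -> - m <= z <= m) ->
  [/\ 0 <= m, a <= m ^+ 2 & a = m ^+ 2 -> A *m A = a%:M].
Proof.
move=> hA n_gt0 trA bnd.
have sq_le i : spectral_diag A 0 i ^+ 2 <= m ^+ 2.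
  have /bnd/andP[lo up] := spectral_diag_eigenvalue _ i hA.
  rewrite -subr_ge0 subr_sqr mulr_ge0 ?subr_ge0 //.
  by rewrite addrC -[m]opprK subr_ge0.
have trE : a *+ n = \sum_i spectral_diag A 0 i ^+ 2.
  rewrite -trA hermitian_squareE // mxtrace_mulC mulmxA.
  rewrite mulmxV ?spectral_unit //.
  by rewrite mul1mx mxtrace_diag; apply: eq_bigr => i _; rewrite mxE.
have sumE b : \sum_(i < n) b = b *+ n :> C by rewrite sumr_const card_ord.
split=> [||a_eq].
- have /bnd/andP[lo up] := spectral_diag_eigenvalue _ (Ordinal n_gt0) hA.
  by rewrite -(pmulrn_lge0 _ (ltn0Sn 1)) mulr2n -lerBlDl sub0r (le_trans lo).
-
  rewrite -(ler_pMn2r n_gt0) trE -sumE.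
  exact: ler_sum.
have sqE i : spectral_diag A 0 i ^+ 2 = a.
  have gap_ge0 j : true -> 0 <= a - spectral_diag A 0 j ^+ 2.
    by rewrite a_eq subr_ge0.
  apply/esym/eqP; rewrite -subr_eq0; apply/eqP.
  by apply: (psumr_eq0P gap_ge0) => //; rewrite sumrB sumE -trE subrr.
rewrite hermitian_squareE //.
have -> : diag_mx (\row_i spectral_diag A 0 i ^+ 2) = a%:M.
  by rewrite -diag_const_mx; congr diag_mx; apply/rowP => i; rewrite !mxE.
by rewrite -mulmxA mul_scalar_mx -scalemxAr mulVmx ?spectral_unit // scalemx1.
Qed.

(** * The magnetic adjacency operator and the bottom of the spectrum *)

Definition magnetic_adjacency {C : numClosedFieldType} {G : sgraph}
    (sigma : G -> G -> C) (f : G -> C) (x : G) : C :=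
  \sum_(y | adj x y) sigma x y * f y.

Lemma magnetic_adjacency_linear {C : numClosedFieldType} {G : sgraph}
    (sigma : G -> G -> C) a (f g : G -> C) x :
  magnetic_adjacency sigma (fun y => a * f y + g y) x =
  a * magnetic_adjacency sigma f x + magnetic_adjacency sigma g x.
Proof.
rewrite /magnetic_adjacency mulr_sumr -big_split.
by apply: eq_bigr => y _; rewrite mulrDr mulrCA.
Qed.

Lemma magnetic_adjacency_scale {C : numClosedFieldType} {G : sgraph}
    (sigma : G -> G -> C) a (f : G -> C) x :
  magnetic_adjacency sigma (fun y => a * f y) x =
  a * magnetic_adjacency sigma f x.
Proof.
by rewrite /magnetic_adjacency mulr_sumr; apply: eq_bigr => y _; rewrite mulrCA.
Qed.

(** Changing the sign of a function on one colour class of a bipartite graph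
turns [A] into [- A]; this is why the spectrum of [A] is symmetric. *)
Lemma magnetic_adjacency_negation {C : numClosedFieldType} {G : sgraph}
    (sigma : G -> G -> C) (c : G -> bool) (f : G -> C) x :
    (forall x y : G, adj x y -> c x != c y) ->
  magnetic_adjacency sigma (fun y => (-1) ^+ c y * f y) x =
  - ((-1) ^+ c x * magnetic_adjacency sigma f x).
Proof.
move=> hc; rewrite /magnetic_adjacency -mulNr mulr_sumr.
apply: eq_bigr => y /hc /=.
by case: (c x); case: (c y) => // _;
  rewrite ?expr0 ?expr1 ?opprK ?mulN1r ?mul1r ?mulrN.
Qed.

Section MagneticSpectrum.
Context {R : realType} {G : sgraph}.
Implicit Types (sigma : G -> G -> R[i]) (f : G -> R[i]).

Lemma regular_eigenvalueP d sigma z : (forall x : G, #|adj x| = d) ->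
  reflect (exists2 f, exists x, f x != 0 &
            forall x, magnetic_adjacency sigma f x = (d%:R - z) * f x)
          (magnetic_eigenvalue sigma z).
Proof.
move=> regG.
have lapE (f : {ffun G -> R[i]^o}) x : magnetic_laplacian sigma f x =
    d%:R * f x - magnetic_adjacency sigma f x.
  by rewrite ffunE sumrB sumr_const -(regG x) mulr_natl.
apply: (iffP (magnetic_eigenvalueP sigma z)) => [[f f0 fE]|[f [x0 fx0] fE]].
  exists f.
    apply: contrapT => fz; case/eqP: f0; apply/ffunP => x; rewrite ffunE.
    by apply: contrapT => /eqP fx; apply: fz; exists x.
  move=> x; have := lapE f x; rewrite fE ffunE /= /GRing.scale /= => E.
  by rewrite mulrBl E opprB addrC subrK.
exists [ffun x => f x : R[i]^o].
  by apply: contra_neq fx0 => /ffunP/(_ x0); rewrite !ffunE.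
apply/ffunP => x; rewrite lapE [RHS]ffunE !ffunE /= /GRing.scale /=.
rewrite /magnetic_adjacency; under eq_bigr => y _ do rewrite ffunE.
by rewrite [X in _ - X]fE mulrBl opprB addrC subrK.
Qed.

(** Matrices act on row vectors from the right, hence the transposed indices. *)
Let adjacency_mx sigma : 'M[R[i]]_#|G| :=
  \matrix_(i, j) if adj (enum_val j) (enum_val i)
                 then sigma (enum_val j) (enum_val i) else 0.

Let adjacency_mxE sigma (v : 'rV_#|G|) x :
  (v *m adjacency_mx sigma) 0 (enum_rank x) =
  magnetic_adjacency sigma (fun y => v 0 (enum_rank y)) x.
Proof.
rewrite mxE [RHS]big_mkcond.
rewrite [RHS](reindex enum_val (onW_bij _ (enum_val_bij _))) /=.
apply: eq_bigr => i _; rewrite mxE enum_rankK enum_valK.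
by case: ifP => _; rewrite ?mulr0 // mulrC.
Qed.

Let adjacency_mx_herm sigma :
  magnetic_potential sigma -> adjacency_mx sigma \is hermsymmx.
Proof.
move=> pot; apply/is_hermitianmxP; rewrite expr0 scale1r; apply/matrixP => i j.
rewrite !mxE adj_sym; case: ifP => [ij|]; last by rewrite conjC0.
by have [s1 ->] := pot _ _ ij; rewrite invC_norm s1 expr1n invr1 mul1r.
Qed.

Let adjacency_mx_trace d sigma : (forall x : G, #|adj x| = d) ->
  magnetic_potential sigma ->
  \tr (adjacency_mx sigma *m adjacency_mx sigma) = d%:R *+ #|G|.
Proof.
move=> regG pot; rewrite -[X in _ *+ X]card_ord -sumr_const.
apply: eq_bigr => i _.
rewrite mxE -(regG (enum_val i)) -sumr_const [RHS]big_mkcond.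
rewrite [RHS](reindex enum_val (onW_bij _ (enum_val_bij _))) /=.
apply: eq_bigr => j _; rewrite !mxE (adj_sym (enum_val j)).
rewrite -[enum_val j \in _]/(adj (enum_val i) (enum_val j)).
case: ifP => [ij|_]; last exact: mul0r.
have [s1 ->] := pot _ _ ij; rewrite mulVf //.
by rewrite -normr_eq0 s1 oner_eq0.
Qed.

(** The number [m = d - l] bounds the eigenvalues of [A] from above because [l]
bounds those of [d - A] from below, and [- m] bounds them from below by the
symmetry of a bipartite spectrum; the trace of [A ^ 2] is [d] times the number
of vertices.  So [hermitian_square_bound] applies. *)
Lemma bipartite_regular_bound d (c : G -> bool) sigma l :
    (0 < #|G|)%N -> (forall x : G, #|adj x| = d) ->
    (forall x y : G, adj x y -> c x != c y) ->
    magnetic_potential sigma ->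
    (forall z, magnetic_eigenvalue sigma z -> l%:C <= z) ->
  l <= d%:R - Num.sqrt d%:R /\
  (l = d%:R - Num.sqrt d%:R -> forall f x,
     magnetic_adjacency sigma (magnetic_adjacency sigma f) x = d%:R * f x).
Proof.
move=> G_gt0 regG hc pot l_le.
pose m : R := d%:R - l.
have bnd z : eigenvalue (adjacency_mx sigma) z -> - m%:C <= z <= m%:C.
  case/eigenvalueP => v vE /rV0Pn[i vi].
  pose f (x : G) := v 0 (enum_rank x).
  have fE x : magnetic_adjacency sigma f x = z * f x.
    by rewrite -adjacency_mxE vE mxE.
  have f0 : exists x, f x != 0 by exists (enum_val i); rewrite /f enum_valK.
  have mE : m%:C = d%:R - l%:C by rewrite rmorphB rmorph_nat.
  have up : l%:C <= d%:R - z.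
    apply: l_le; apply/(regular_eigenvalueP d) => //; exists f => // x.
    by rewrite fE opprB addrCA subrr addr0.
  have lo : l%:C <= d%:R + z.
    apply: l_le; apply/(regular_eigenvalueP d) => //.
    exists (fun y => (-1) ^+ c y * f y).
      by case: f0 => x fx; exists x; rewrite mulf_neq0 ?signr_eq0.
    move=> x; rewrite magnetic_adjacency_negation // fE opprD addrA subrr.
    by rewrite add0r mulNr mulrCA.
  rewrite mE opprB lerBlDl lo /=.
  by rewrite lerBrDl -lerBrDr.
have [] := hermitian_square_bound (adjacency_mx sigma) m%:C d%:R
  (adjacency_mx_herm _ pot) G_gt0 (adjacency_mx_trace _ _ regG pot) bnd.
rewrite -(rmorph_nat (real_complex R)) -rmorphXn !lecR => m_ge0 d_le sqE.
have root_le : Num.sqrt d%:R <= m.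
  by rewrite -[m]ger0_norm // -sqrtr_sqr ler_wsqrtr.
split=> [|lE f x]; first by rewrite lerBrDl -lerBrDr.
have {}sqE : adjacency_mx sigma *m adjacency_mx sigma = (d%:R : R)%:C%:M.
  apply: sqE; congr (_%:C).
  by rewrite /m lE opprB addrC subrK sqr_sqrtr.
pose v : 'rV_#|G| := \row_i f (enum_val i).
have -> : f = fun y => v 0 (enum_rank y).
  by apply/funext => y; rewrite mxE enum_rankK.
have -> : magnetic_adjacency sigma (fun y => v 0 (enum_rank y)) =
    fun y => (v *m adjacency_mx sigma) 0 (enum_rank y).
  by apply/funext => y; rewrite adjacency_mxE.
by rewrite -adjacency_mxE -mulmxA sqE mul_mx_scalar mxE.
Qed.

(** From [A ^ 2 = d] every eigenvalue [z] of [d - A] satisfies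
[(d - z) ^ 2 = d].  The smaller solution [d - sqrt d] is an eigenvalue: [A] maps
[sqrt d * e + A e] to [sqrt d] times itself for every [e]. *)
Lemma lambda1_of_square d sigma :
    (0 < d)%N -> (0 < #|G|)%N -> (forall x : G, #|adj x| = d) ->
    (forall f x, magnetic_adjacency sigma (magnetic_adjacency sigma f) x =
       d%:R * f x) ->
  lambda1 sigma = d%:R - Num.sqrt d%:R.
Proof.
move=> d_gt0 /card_gt0P[x0 _] regG sqE; rewrite /lambda1.
set S : set R := [set l | _]%classic.
pose r : R[i] := (Num.sqrt d%:R)%:C.
have r_sq : r ^+ 2 = d%:R.
  by rewrite -rmorphXn /= sqr_sqrtr // rmorph_nat.
have r_ge0 : 0 <= r by rewrite lecR sqrtr_ge0.
have lE : (d%:R - Num.sqrt d%:R)%:C = d%:R - r by rewrite rmorphB rmorph_nat.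
have r_low z : magnetic_eigenvalue sigma z -> (d%:R - Num.sqrt d%:R)%:C <= z.
  case/(regular_eigenvalueP d _ _ regG) => f [x fx] fE; rewrite lE.
  have /eqP : (d%:R - z) ^+ 2 = r ^+ 2.
    apply: (mulIf fx); rewrite r_sq -sqE (funext fE).
    by rewrite magnetic_adjacency_scale fE mulrA.
  rewrite eqf_sqr => /orP[] /eqP; first by move <-; rewrite opprB addrC subrK.
  move=> dz; rewrite -[z](subKr d%:R) dz opprK lerD2l.
  by rewrite (le_trans _ r_ge0) // oppr_le0.
have r_eigen : magnetic_eigenvalue sigma (d%:R - Num.sqrt d%:R)%:C.
  apply/(regular_eigenvalueP d _ _ regG).
  (* For a delta function [e] the candidate eigenfunction takes the value
     [sqrt d] at [x0], since a simple graph has no loop at [x0]. *)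
  pose e (y : G) : R[i] := (y == x0)%:R.
  exists (fun y => r * e y + magnetic_adjacency sigma e y).
    exists x0; rewrite /e eqxx mulr1 /magnetic_adjacency big1 ?addr0.
      by rewrite -sqrf_eq0 r_sq pnatr_eq0 -lt0n.
    move=> y x0y; case: eqP => [yx0|_]; last by rewrite mulr0.
    by rewrite yx0 adj_irrefl in x0y.
  move=> x; rewrite magnetic_adjacency_linear sqE lE subKr -r_sq mulrDr.
  by rewrite addrC expr2 mulrA.
have : S (xget 0 S) by apply: xgetI; split; [exact: r_eigen | exact: r_low].
case=> /r_low le1 /(_ _ r_eigen) le2.
by apply/complexI/le_anti; rewrite le1 le2.
Qed.
End MagneticSpectrum.
(** * The hypercube *)

Section Cube.
Context {d : nat}.
Implicit Types (x y : {ffun 'I_d -> bool}) (i j k l : 'I_d).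

Definition flip i x : {ffun 'I_d -> bool} := [ffun j => x j (+) (j == i)].

Lemma flipK i : involutive (flip i).
Proof. by move=> x; apply/ffunP => j; rewrite !ffunE -addbA addbb addbF. Qed.

Lemma flipC i j x : flip i (flip j x) = flip j (flip i x).
Proof. by apply/ffunP => k; rewrite !ffunE addbAC. Qed.

Lemma flip_inj_dir x : injective (fun i => flip i x).
Proof.
by move=> i j /ffunP/(_ i); rewrite !ffunE eqxx => /addbI/esym/eqP.
Qed.

(** Two vertices at distance two have exactly two common neighbours. *)
Lemma flip2_eq i j k l x : i != j ->
  flip l (flip k x) = flip j (flip i x) -> k = i /\ l = j \/ k = j /\ l = i.
Proof.
move=> /negbTE ij E; have [ki|ki] := eqVneq k i.
  by left; split=> //; subst k; apply: (flip_inj_dir (flip i x)).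
suff li : l = i.
  right; split=> //; subst l; apply: (flip_inj_dir x).
  by apply: (can_inj (flipK i)); rewrite E flipC.
move/ffunP/(_ i): E; rewrite !ffunE eqxx ij [i == k]eq_sym (negbTE ki) !addbF.
by move=> /addbI/eqP.
Qed.

Lemma cube_adjP x y : reflect (exists i, y = flip i x) (cube_adj x y).
Proof.
apply: (iffP cards1P) => [[i /setP xy]|[i ->]]; exists i; last first.
  apply/setP => j; rewrite !inE ffunE.
  by case: (x j); case: (j == i).
apply/ffunP => j; move: (xy j); rewrite !inE ffunE => <-.
by case: (x j); case: (y j).
Qed.

Lemma flip_adj i x : cube_adj x (flip i x).
Proof. by apply/cube_adjP; exists i. Qed.

Lemma big_cube_adj (T : Type) (idx : T) (op : Monoid.com_law idx) x F :
  \big[op/idx]_(y | cube_adj x y) F y = \big[op/idx]_i F (flip i x).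
Proof.
rewrite (eq_bigl (mem [set flip i x | i in predT])).
  by rewrite big_imset //; apply: in2W; apply: flip_inj_dir.
move=> y; apply/cube_adjP/imsetP => [[i ->]|[i _ ->]]; exists i => //.
Qed.

Lemma cube_regular x : #|@cube_adj d x| = d.
Proof.
by rewrite -sum1_card (big_cube_adj _ _ _ x (fun=> 1%N)) sum1_card card_ord.
Qed.

Definition parity x : bool := \big[addb/false]_i x i.

Lemma parity_adj x y : cube_adj x y -> parity x != parity y.
Proof.
move=> /cube_adjP[i ->].
suff -> : parity (flip i x) = ~~ parity x by case: (parity x).
rewrite /parity; under eq_bigr => j _ do rewrite ffunE.
rewrite big_split /= [X in _ (+) X](bigD1 i) //= eqxx.
rewrite [X in _ (+) (_ (+) X)]big1 ?addbF ?addbT //.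
by move=> j /negbTE.
Qed.

(** Distinct vertices exclude walks that go back, so opposite edges of a 4-cycle
are parallel and the cycle is determined by a vertex and two directions. *)
Lemma cube_4cycleP x1 x2 x3 x4 :
  reflect (exists2 ij : 'I_d * 'I_d, ij.1 != ij.2 &
     [/\ x2 = flip ij.1 x1, x3 = flip ij.2 (flip ij.1 x1) & x4 = flip ij.2 x1])
    (ucycleb (@cube_adj d) [:: x1; x2; x3; x4]).
Proof.
apply: (iffP andP) => /=.
  case=> /and5P[/cube_adjP[i ->] /cube_adjP[j ->] x34 x41 _].
  rewrite !inE !negb_or -!andbA => /and5P[_ x13 _ _ /andP[x24 _]].
  move: x41; rewrite cube_adj_sym => /cube_adjP[l x4E].
  move: x34; rewrite cube_adj_sym => /cube_adjP[k x3E]; subst x4.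
  have ij : i != j.
    by apply: contraNneq x13 => ->; rewrite flipK.
  exists (i, j) => //=; split=> //.
  case: (flip2_eq i j l k x1 ij) => [|[]|[->]] //; last first.
  by move=> li; rewrite li eqxx in x24.
case=> -[i j] /= ij [-> -> ->]; split.
  by rewrite !flip_adj cube_adj_sym flipC flip_adj cube_adj_sym flip_adj.
have neq k x : x != flip k x.
  by apply/eqP => /ffunP/(_ k); rewrite !ffunE eqxx; case: (x k).
have neq2 x : flip i x != flip j x by apply: contra_neq ij => /flip_inj_dir.
have x13 : x1 != flip j (flip i x1).
  apply: contra_neq ij => E; apply: (flip_inj_dir (flip i x1)).
  by rewrite /= flipK -E.
by rewrite /= !inE !negb_or x13 !neq neq2 flipC eq_sym neq.
Qed.
End Cube.
(** * Potentials on the hypercube and their 4-cycles *)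

Section CubePotential.
Context {R : realType} {d : nat}.
Implicit Types (sigma rho : hypercube d -> hypercube d -> R[i]).
Implicit Types (x y : {ffun 'I_d -> bool}) (i j k l : 'I_d).

Definition two_step sigma i j x :=
  sigma x (flip i x) * sigma (flip i x) (flip j (flip i x)).

Definition anticommuting sigma :=
  forall x i j, i != j -> two_step sigma i j x = - two_step sigma j i x.

Lemma potential_neq0 sigma x y :
  magnetic_potential sigma -> cube_adj x y -> sigma x y != 0.
Proof. by move=> pot /(pot x y)[s1 _]; rewrite -normr_eq0 s1 oner_eq0. Qed.

Lemma two_step_neq0 sigma i j x :
  magnetic_potential sigma -> two_step sigma i j x != 0.
Proof. by move=> pot; rewrite mulf_neq0 // potential_neq0 // flip_adj. Qed.

(** Reversing two edges of the cycle inverts their values, so the product along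
the 4-cycle is the quotient of the products along its two halves. *)
Lemma minus_one_on_4cyclesP sigma : magnetic_potential sigma ->
  minus_one_on_4cycles sigma <-> anticommuting sigma.
Proof.
move=> pot.
have cycleE x i j :
    sigma x (flip i x) * sigma (flip i x) (flip j (flip i x)) *
      sigma (flip j (flip i x)) (flip j x) * sigma (flip j x) x =
    two_step sigma i j x / two_step sigma j i x.
  rewrite /two_step flipC invfM -!mulrA; congr (_ * (_ * _)).
  have [_ ->] := pot _ _ (flip_adj i (flip j x)).
  by have [_ ->] := pot _ _ (flip_adj j x); rewrite mulrC.
split=> [neg x i j ij|anti x1 x2 x3 x4].
  have := neg x (flip i x) (flip j (flip i x)) (flip j x).
  rewrite cycleE => E.
  apply: (mulIf (invr_neq0 (two_step_neq0 sigma j i x pot))).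
  rewrite mulNr divff ?two_step_neq0 //; apply: E.
  by apply/cube_4cycleP; exists (i, j).
case/cube_4cycleP => -[i j] /= ij [-> -> ->]; rewrite cycleE anti //.
by rewrite mulNr divff ?two_step_neq0.
Qed.

Lemma cube_adjacency_square sigma f x :
  magnetic_adjacency sigma (magnetic_adjacency sigma f) x =
  \sum_i \sum_j two_step sigma i j x * f (flip j (flip i x)).
Proof.
rewrite /magnetic_adjacency /= big_cube_adj; apply: eq_bigr => i _.
rewrite big_cube_adj mulr_sumr; apply: eq_bigr => j _; exact: mulrA.
Qed.

(** Applied to the delta function of a vertex at distance two from [x], the
square of [A] returns at [x] the sum over the two walks joining them. *)
Lemma square_anticommuting sigma :
    (forall f x, magnetic_adjacency sigma (magnetic_adjacency sigma f) x =
       d%:R * f x) ->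
  anticommuting sigma.
Proof.
move=> sqE x i j ij; set z := flip j (flip i x).
pose e (y : hypercube d) : R[i] := (y == z)%:R.
have := sqE e x; rewrite cube_adjacency_square {2}/e.
have -> : (x == z) = false.
  apply: contra_neqF ij => /eqP xz; apply: (flip_inj_dir (flip i x)).
  by rewrite /= flipK -/z -xz.
have eE k l : e (flip l (flip k x)) = ((k, l) \in [:: (i, j); (j, i)])%:R.
  rewrite /e !inE; congr (nat_of_bool _)%:R.
  apply/eqP/orP => [/(flip2_eq _ _ _ _ _ ij)[] [-> ->]|[] /eqP[-> ->]].
  - by left.
  - by right.
  - by [].
  - by rewrite flipC.
rewrite mulr0 pair_big /=.
under eq_bigr => p _ do rewrite eE -surjective_pairing.
rewrite (bigD1 (i, j)) // (bigD1 (j, i)) /=; last first.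
  by rewrite xpair_eqE negb_and eq_sym ij.
rewrite big1 => [|p /andP[pij pji]]; last first.
  by rewrite !inE (negbTE pij) (negbTE pji) mulr0.
by rewrite !inE !eqxx orbT !mulr1 addr0 => /eqP; rewrite addr_eq0 => /eqP.
Qed.

(** In the double sum over pairs of directions the two orders of a pair of
distinct directions lead to the same vertex with opposite weights, and each of
the [d] walks going forth and back has weight [1]. *)
Lemma anticommuting_square sigma f x :
    magnetic_potential sigma -> anticommuting sigma ->
  magnetic_adjacency sigma (magnetic_adjacency sigma f) x = d%:R * f x.
Proof.
move=> pot anti; rewrite cube_adjacency_square.
pose T i j := two_step sigma i j x * f (flip j (flip i x)).
have TT i : T i i = f x.
  rewrite /T /two_step !flipK; have [_ ->] := pot _ _ (flip_adj i x).
  by rewrite mulfV ?mul1r // potential_neq0 // flip_adj.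
have Tsym i j : T i j + T j i = if j == i then f x + f x else 0.
  have [->|ji] := eqVneq j i; first by rewrite TT.
  by rewrite /T flipC anti 1?eq_sym // mulNr addNr.
(* Adding to the sum its transpose makes the cancellation termwise. *)
have two : (\sum_i \sum_j T i j) *+ 2 = (d%:R * f x) *+ 2.
  rewrite {1}mulr2n {2}exchange_big -big_split /=.
  under eq_bigr => i _.
    rewrite -big_split /=; under eq_bigr => j _ do rewrite Tsym.
    rewrite -big_mkcond big_pred1_eq; over.
  by rewrite sumr_const card_ord -mulr2n mulr_natl -mulrnA mulnC mulrnA.
by move/eqP: two; rewrite eqrMn2r => /eqP.
Qed.


(** * Flat potentials and gauge equivalence *)

Let weight x := #|[set i | x i]|.

Let weight_flip i x : x i -> weight x = (weight (flip i x)).+1.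
Proof.
move=> xi; rewrite /weight (cardsD1 i) inE xi add1n; congr _.+1.
apply: eq_card => j; rewrite !inE ffunE andbC.
by have [->|_] := eqVneq j i; rewrite ?xi ?andbF //= andbT addbF.
Qed.

(** A potential function [tau] is built by increasing number of ones, following
[rho] along some edge coming from below.  All edges from below give the same
value: two of them, in directions [i] and [k], complete to a square whose two
lower edges are covered by the induction hypothesis, and flatness of [rho] on
this square compares the upper ones. *)
Lemma flat_potential_gradient rho : magnetic_potential rho ->
    (forall x i j, two_step rho i j x = two_step rho j i x) ->
  exists tau : hypercube d -> R[i], (forall x, `|tau x| = 1) /\
    forall x y, cube_adj x y -> rho x y = (tau x)^-1 * tau y.
Proof.
move=> pot flat.
have neq0 x y : cube_adj x y -> rho x y != 0 by exact: potential_neq0.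
have tau_exists n : exists tau : hypercube d -> R[i],
    (forall x, `|tau x| = 1) /\ forall x i, x i -> (weight x <= n)%N ->
      tau x = tau (flip i x) * rho (flip i x) x.
  elim: n => [|n [tau [tau1 tauE]]].
    exists (fun=> 1); split=> [x|x i xi]; first exact: normr1.
    by rewrite (weight_flip i).
  pose step x := if [pick i | x i] is Some i
                 then tau (flip i x) * rho (flip i x) x else 1.
  exists (fun x => if weight x == n.+1 then step x else tau x).
  split=> [x|x i xi].
    case: ifP => // _; rewrite /step.
    case: pickP => [i _|_]; last exact: normr1.
    have [r1 _] := pot _ _ (flip_adj i (flip i x)).
    by rewrite flipK in r1; rewrite normrM tau1 r1 mulr1.
  rewrite (weight_flip i x xi) ltnS eqSS => w_le; rewrite [_ == n.+1]ltn_eqF //.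
  have [wE|w_neq] := eqVneq (weight (flip i x)) n; last first.
    by apply: tauE => //; rewrite (weight_flip i x xi) ltn_neqAle w_neq.
  rewrite /step; case: pickP => [k /= xk|/(_ i)]; last by rewrite xi.
  have [->//|ki] := eqVneq k i.
  have xki : flip k x i by rewrite ffunE xi eq_sym (negbTE ki).
  have xik : flip i x k by rewrite ffunE xk (negbTE ki).
  have wk : weight (flip k x) = n.
    by apply: succn_inj; rewrite -weight_flip // (weight_flip i) // wE.
  rewrite (tauE _ _ xki) ?wk // (tauE _ _ xik) ?wE // [flip k (flip i x)]flipC.
  have := flat (flip i (flip k x)) i k; rewrite /two_step flipK flipK.
  by rewrite [flip k (flip i (flip k x))]flipC flipK flipK -!mulrA => ->.
have [tau [tau1 tauE]] := tau_exists d.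
have w_le x : (weight x <= d)%N.
  by rewrite -[X in (_ <= X)%N](card_ord d); apply: max_card.
have tau_neq0 x : tau x != 0 by rewrite -normr_eq0 tau1 oner_eq0.
exists tau; split=> // x _ /cube_adjP[i ->].
have [xi|/negbTE xi] := boolP (x i).
  have back : cube_adj (flip i x) x by rewrite cube_adj_sym flip_adj.
  have [_ ->] := pot _ _ back.
  by rewrite (tauE x i) // invfM mulrAC mulVf // mul1r.
rewrite (tauE (flip i x) i) //; last by rewrite ffunE xi eqxx.
by rewrite flipK mulKf.
Qed.

Lemma anticommuting_gauge_equivalent sigma1 sigma2 :
    magnetic_potential sigma1 -> magnetic_potential sigma2 ->
    anticommuting sigma1 -> anticommuting sigma2 ->
  gauge_equivalent sigma1 sigma2.
Proof.
move=> pot1 pot2 anti1 anti2.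
pose rho (x y : hypercube d) := sigma2 x y / sigma1 x y.
have pot : magnetic_potential rho.
  move=> x y xy; have [n1 inv1] := pot1 _ _ xy; have [n2 inv2] := pot2 _ _ xy.
  by rewrite /rho normrM normfV n1 n2 inv1 inv2 invr1 mulr1 invfM.
have rhoE i j x :
    two_step rho i j x = two_step sigma2 i j x / two_step sigma1 i j x.
  by rewrite /two_step /rho mulrACA invfM.
have [|tau [tau1 tauE]] := flat_potential_gradient rho pot.
  move=> x i j; rewrite !rhoE; have [->//|ij] := eqVneq i j.
  by rewrite anti1 // anti2 // invrN mulrNN.
exists tau; split=> // x y xy.
by rewrite mulrAC -tauE // /rho divfK // potential_neq0.
Qed.

(** * An anticommuting potential *)

Definition parity_below i x : bool :=
  \big[addb/false]_(j : 'I_d | (j < i)%N) x j.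

Lemma parity_below_flip i k x :
  parity_below i (flip k x) = parity_below i x (+) (k < i)%N.
Proof.
rewrite /parity_below; under eq_bigr => j _ do rewrite ffunE.
rewrite big_split /=; congr (_ (+) _); have [ki|ki] := boolP (k < i)%N.
  rewrite (bigD1 k) //= eqxx big1 // => j /andP[_ /negbTE] //.
rewrite big1 // => j ji; apply: contraNF ki => /eqP <- //.
Qed.

(** On an edge in direction [i] this is the sign [(-1) ^ (x_0 + ... + x_(i-1))]
produced by moving the [i]-th generator of a Clifford algebra (or of an exterior
algebra) into its place among those present in [x].  The product ranges over a
single index when [x] and [y] are adjacent. *)
Definition alternating_potential (x y : hypercube d) : R[i] :=
  \prod_(i | x i != y i) (-1) ^+ parity_below i x.

Lemma alternating_flip i x :
  alternating_potential x (flip i x) = (-1) ^+ parity_below i x.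
Proof.
rewrite /alternating_potential (big_pred1 i) // => j /=.
by rewrite ffunE; case: (x j); case: (j == i).
Qed.

Lemma alternating_is_potential : magnetic_potential alternating_potential.
Proof.
move=> x _ /cube_adjP[i ->]; have := alternating_flip i (flip i x).
rewrite flipK parity_below_flip ltnn addbF => ->; rewrite alternating_flip.
by rewrite normrX normrN1 expr1n invr_sign.
Qed.

(** Of two distinct directions exactly one is below the other, so exactly one of
the two orders of flipping sees its second sign changed by the first flip. *)
Lemma alternating_anticommuting : anticommuting alternating_potential.
Proof.
move=> x i j ij; rewrite /two_step !alternating_flip !parity_below_flip.
rewrite -!signr_addb -signrN; congr (_ ^+ nat_of_bool _).
have : (i < j)%N = ~~ (j < i)%N by rewrite -leqNgt ltn_neqAle ij.
by move=> ->; case: (parity_below i x); case: (parity_below j x);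
  case: (j < i)%N.
Qed.
End CubePotential.

(** * The magneto-spectral height of the hypercube *)

Section HypercubeHeight.
Context {R : realType} {d : nat}.
Hypothesis d_gt1 : (1 < d)%N.
Implicit Types sigma : hypercube d -> hypercube d -> R[i].

Let b : R := d%:R - Num.sqrt d%:R.

Let b_gt0 : 0 < b.
Proof.
have r_gt1 : 1 < Num.sqrt d%:R :> R.
  by rewrite -[X in X < _]sqrtr1 ltr_sqrt ?ltr1n // ltr0n ltnW.
rewrite subr_gt0 -[X in _ < X](@sqr_sqrtr _ d%:R) ?ler0n // expr2.
by rewrite ltr_pMr // (lt_trans ltr01).
Qed.

Let cube_gt0 : (0 < #|hypercube d|)%N.
Proof. by apply/card_gt0P; exists [ffun=> false]. Qed.

(** If the defining set of [lambda1] were empty its value would be [0],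
which for [d >= 2] lies strictly below [d - sqrt d]; so the claim holds in this
case too. *)
Lemma lambda1_hypercube_bound sigma : magnetic_potential sigma ->
  lambda1 sigma <= d%:R - Num.sqrt d%:R /\
  (lambda1 sigma = d%:R - Num.sqrt d%:R -> anticommuting sigma).
Proof.
move=> pot; rewrite -/b /lambda1; case: xgetP => [l _ [_ l_le]|_].
  have [l_le_b sq] := bipartite_regular_bound d (parity : hypercube d -> bool)
    sigma l cube_gt0 cube_regular parity_adj pot l_le.
  by split=> // /sq /square_anticommuting.
by split=> [|b0]; [exact: ltW | move: b_gt0; rewrite -b0 ltxx].
Qed.

Lemma lambda1_anticommuting sigma : magnetic_potential sigma ->
  anticommuting sigma -> lambda1 sigma = d%:R - Num.sqrt d%:R.
Proof.
move=> pot anti; apply: lambda1_of_square => //; first exact: ltnW.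
  exact: cube_regular.
by move=> f x; apply: anticommuting_square.
Qed.

Lemma hypercube_height :
  magneto_spectral_height R (hypercube d) = d%:R - Num.sqrt d%:R.
Proof.
rewrite /magneto_spectral_height; set S := image _ _.
have Sb : S b.
  exists alternating_potential; first exact: alternating_is_potential.
  exact: lambda1_anticommuting alternating_is_potential
    alternating_anticommuting.
have S_ub : ubound S b by move=> _ [sigma /lambda1_hypercube_bound[le _] <-].
apply/le_anti; rewrite ge_sup //=; last by exists b.
by apply: ub_le_sup => //; exists b.
Qed.

Lemma maximal_anticommutingP sigma : magnetic_potential sigma ->
  maximal_potential sigma <-> anticommuting sigma.
Proof.
move=> pot; split=> [[_]|anti].
  by rewrite hypercube_height; have [_] := lambda1_hypercube_bound sigma pot.
by split=> //; rewrite hypercube_height lambda1_anticommuting.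
Qed.
End HypercubeHeight.

Theorem proposition2p15 (R : realType) (d : nat) (hd : (2 <= d)%N) :
  [/\ magneto_spectral_height R (hypercube d) = d%:R - Num.sqrt d%:R,
      forall sigma : hypercube d -> hypercube d -> R[i],
        magnetic_potential sigma ->
        (maximal_potential sigma <-> minus_one_on_4cycles sigma)
    & forall sigma1 sigma2 : hypercube d -> hypercube d -> R[i],
        maximal_potential sigma1 -> maximal_potential sigma2 ->
        gauge_equivalent sigma1 sigma2].
Proof.
split=> [|sigma pot|sigma1 sigma2 max1 max2].
- exact: hypercube_height.
- exact: iff_trans (maximal_anticommutingP hd _ pot)
                   (iff_sym (minus_one_on_4cyclesP _ pot)).
- have [[pot1 _] [pot2 _]] := (max1, max2).
  apply: anticommuting_gauge_equivalent => //.
  + exact/(maximal_anticommutingP hd _ pot1).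
  + exact/(maximal_anticommutingP hd _ pot2).
Qed.
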